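(* The relations $\vartriangleleft$ and $\trianglelefteq$ are well-defined on $\mathcal{S}=\widetilde{\mathcal{S}}/\sim$. That is: if $S_0,S_1,T_0,T_1\in\widetilde{\mathcal{S}}$ satisfy $S_0\sim S_1$ and $T_0\sim T_1$, then $S_0\vartriangleleft T_0$ if and only if $S_1\vartriangleleft T_1$; and hence also ($S_0\vartriangleleft T_0$ or $S_0\sim T_0$) if and only if ($S_1\vartriangleleft T_1$ or $S_1\sim T_1$).
   Context: Consider $\mathbb{R}^4$ with coordinates $(x_1,x_2,y_1,y_2)$ and symplectic form $dx_1\wedge dy_1+dx_2\wedge dy_2$. Let $L_0=\{y_1=y_2=0\}$. A flat-at-infinity planar Lagrangian is an embedded Lagrangian submanifold of $\mathbb{R}^4$ that is diffeomorphic to $\mathbb{R}^2$ and agrees with $L_0$ outside a compact subset of $\mathbb{R}^4$. For such $L$ and $a\in\mathbb{R}$, $L_a=L\cap\{y_2=a\}$. Use coordinates $(x_1,y_1,x_2)$ on $\mathbb{R}^3$ and let $i_a:\mathbb{R}^3\to\{y_2=a\}\subset\mathbb{R}^4$ be the inclusion $(x_1,y_1,x_2)\mapsto(x_1,x_2,y_1,a)$. A link $S\subset\mathbb{R}^3$ is a (generic) negative Lagrangian slice if there are a flat-at-infinity planar Lagrangian $L$ and $a<0$ such that $L$ is transverse to $\{y_2=a\}$ and $L_a=i_a(S)$. Let $\widetilde{\mathcal{S}}$ be the set of all negative Lagrangian slices together with the empty set. For $S_1,S_2\in\widetilde{\mathcal{S}}$ write $S_1\sim S_2$ if there is a compactly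 supported area-preserving diffeomorphism $\varphi$ of the $x_1y_1$-plane with $(\varphi\times\mathrm{id})(S_1)=S_2$, where $\mathrm{id}$ acts on the $x_2$-coordinate. For $S,S'\in\widetilde{\mathcal{S}}$, $S\vartriangleleft S'$ means: there exist a flat-at-infinity planar Lagrangian $L$ and $a<b<0$, with $L$ transverse to $\{y_2=a\}$ and $\{y_2=b\}$, such that $i_a(S)=L_a$ and $i_b(S')=L_b$. The relation $\trianglelefteq$ is defined in the same way with $a\le b<0$; on equivalence classes, $[S]\trianglelefteq[S']$ means $[S]\vartriangleleft[S']$ or $[S]=[S']$. *)

(* Defs.v *)
From HB Require Import structures.
From mathcomp Require Import all_boot all_order all_algebra.
From mathcomp Require Import all_classical all_reals all_analysis.

Set Implicit Arguments.
Unset Strict Implicit.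
Unset Printing Implicit Defensive.

Import Order.TTheory GRing.Theory Num.Theory.
Import numFieldNormedType.Exports.

Local Open Scope classical_set_scope.
Local Open Scope ring_scope.

(* C^k and C^oo maps. In finite dimension a differentiable map is C^(k+1) as
   soon as each of its directional derivatives is C^k. *)
Fixpoint Ck (R : realType) (V W : normedModType R) (k : nat) (f : V -> W)
    : Prop :=
  if k is k'.+1 then
    (forall x, differentiable f x) /\ (forall v, Ck k' (fun x => 'D_v f x))
  else continuous f.

Definition smooth (R : realType) (V W : normedModType R) (f : V -> W) : Prop :=
  forall k, Ck k f.

Definition smooth_embedding (R : realType) (V W : normedModType R)
    (f : V -> W) : Prop :=
  [/\ smooth f, injective f, forall u, injective ('d f u : V -> W) &
      forall U : set V, open U ->
        exists2 O : set W, open O & f @` U = O `&` range f].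

(* Velocities at p of smooth curves staying in A; when A is an embedded
   submanifold these are exactly the vectors of T_p A. *)
Definition tangent (R : realType) (V : normedModType R)
    (A : set V) (p v : V) : Prop :=
  exists c : R -> V,
    [/\ smooth c, c 0 = p, \forall t \near 0, A (c t) & derive1 c 0 = v].

Definition transverse (R : realType) (V : normedModType R) (A B : set V)
    : Prop :=
  forall p, A p -> B p -> forall v, exists u w,
    [/\ tangent A p u, tangent B p w & v = u + w].

(* R^4 carries the coordinates (x1, x2, y1, y2), in this order. *)
Definition x1 (R : realType) (p : 'rV[R]_4) : R := p 0 0.
Definition x2 (R : realType) (p : 'rV[R]_4) : R := p 0 1.
Definition y1 (R : realType) (p : 'rV[R]_4) : R := p 0 2%:R.
Definition y2 (R : realType) (p : 'rV[R]_4) : R := p 0 3%:R.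

(* dx1 /\ dy1 + dx2 /\ dy2 *)
Definition omega (R : realType) (v w : 'rV[R]_4) : R :=
  (x1 v * y1 w - x1 w * y1 v) + (x2 v * y2 w - x2 w * y2 v).

Definition L0 (R : realType) : set 'rV[R]_4 :=
  [set p | y1 p = 0 /\ y2 p = 0].

Definition y2_level (R : realType) (a : R) : set 'rV[R]_4 :=
  [set p | y2 p = a].

(* An embedded submanifold diffeomorphic to R^2 is the image of a smooth
   embedding of R^2; being 2-dimensional in R^4, it is Lagrangian iff omega
   vanishes on its tangent spaces. *)
Definition flat_planar_lagrangian (R : realType) (L : set 'rV[R]_4) : Prop :=
  [/\ exists2 f : 'rV[R]_2 -> 'rV[R]_4, smooth_embedding f & range f = L,
      forall p v w, L p -> tangent L p v -> tangent L p w -> omega v w = 0 &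
      exists2 K : set 'rV[R]_4, compact K & L `\` K = @L0 R `\` K].

Definition slice (R : realType) (L : set 'rV[R]_4) (a : R) : set 'rV[R]_4 :=
  L `&` y2_level a.

(* R^3 carries the coordinates (x1, y1, x2), in this order. *)
Definition i_level (R : realType) (a : R) (q : 'rV[R]_3) : 'rV[R]_4 :=
  \row_j [:: q 0 0; q 0 2%:R; q 0 1; a]`_j.

(* A nonempty finite union of pairwise disjoint smoothly embedded circles, each
   given by a 1-periodic parametrization. *)
Definition link (R : realType) (S : set 'rV[R]_3) : Prop :=
  exists (k : nat) (g : 'I_k.+1 -> R -> 'rV[R]_3),
    [/\ forall i, smooth (g i),
        forall i t, g i (t + 1) = g i t,
        forall i t, derive1 (g i) t != 0,
        forall i j s t, g i s = g j t ->
          i = j /\ exists m : int, s - t = m%:~R &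
        S = \bigcup_i range (g i)].

Definition negative_slice (R : realType) (S : set 'rV[R]_3) : Prop :=
  link S /\
  exists (L : set 'rV[R]_4) (a : R),
    [/\ flat_planar_lagrangian L, a < 0, transverse L (y2_level a) &
        slice L a = i_level a @` S].

(* Negative Lagrangian slices together with the empty set. *)
Definition slices (R : realType) : set (set 'rV[R]_3) :=
  [set S | negative_slice S \/ S = set0].

(* The plane 'rV_2 carries the coordinates (x1, y1); this is dx1 /\ dy1. *)
Definition area (R : realType) (v w : 'rV[R]_2) : R :=
  v 0 0 * w 0 1 - w 0 0 * v 0 1.

(* A diffeomorphism preserves area when it preserves dx1 /\ dy1; compact support
   excludes the orientation-reversing case. *)
Definition compact_area_diffeo (R : realType) (phi : 'rV[R]_2 -> 'rV[R]_2)
    : Prop :=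
  [/\ smooth phi,
      exists psi, [/\ smooth psi, cancel phi psi & cancel psi phi],
      forall p v w, area ('d phi p v) ('d phi p w) = area v w &
      exists2 K : set 'rV[R]_2, compact K & forall p, ~ K p -> phi p = p].

(* phi x id on R^3 = (x1 y1-plane) x (x2-axis) *)
Definition prod_id (R : realType) (phi : 'rV[R]_2 -> 'rV[R]_2) (q : 'rV[R]_3)
    : 'rV[R]_3 :=
  let z := phi (\row_j [:: q 0 0; q 0 1]`_j) in
  \row_j [:: z 0 0; z 0 1; q 0 2%:R]`_j.

Definition slice_equiv (R : realType) (S1 S2 : set 'rV[R]_3) : Prop :=
  exists2 phi, compact_area_diffeo phi & prod_id phi @` S1 = S2.

Definition slice_prec (R : realType) (S S' : set 'rV[R]_3) : Prop :=
  exists (L : set 'rV[R]_4) (a b : R),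
    [/\ flat_planar_lagrangian L,
        a < b /\ b < 0,
        transverse L (y2_level a) /\ transverse L (y2_level b),
        i_level a @` S = slice L a &
        i_level b @` S' = slice L b].

(* The reflexive version on equivalence classes, read on representatives. *)
Definition slice_preceq (R : realType) (S S' : set 'rV[R]_3) : Prop :=
  slice_prec S S' \/ slice_equiv S S'.

(* Main.v *)
(* Let phi be a compactly supported area-preserving diffeomorphism of the x1
   y1-plane and a < 0 a level. No isotopy from phi to the identity is needed:
   the shear
     (x1, x2, y1, y2) |->
       (x1, x2 - 2 c (y2 - a) x1, y1 + c (y2 - a)^2, y2)
   is symplectic, preserves every level of y2 and fixes the level a pointwise.
   Conjugating phi x id by it gives a symplectic diffeomorphism F of R^4 that
   is phi x id on the level a; on the level t its support is translated by
   c (t - a)^2 in the y1 direction. Since y1 is bounded on L, for c large F is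
   the identity on L away from a small neighbourhood of the level a, which
   contains neither the other level nor y2 = 0. So F(L) is again flat at
   infinity, has the slice changed by phi at the level a, and keeps the other
   slice. Doing this at the two levels in turn transports a pair of slices. *)
Require Import Defs.
From mathcomp Require Import all_boot all_order all_algebra.
From mathcomp Require Import ring lra.
From mathcomp Require Import all_classical all_reals all_analysis.

Set Implicit Arguments.
Unset Strict Implicit.
Unset Printing Implicit Defensive.

Import Order.TTheory GRing.Theory Num.Theory.
Import numFieldNormedType.Exports.

Local Open Scope classical_set_scope.
Local Open Scope ring_scope.

(** * Smooth maps *)

Section Ck_theory.
Variable R : realType.
Implicit Types V W : normedModType R.

Lemma Ck_continuous V W k (f : V -> W) : Ck k f -> continuous f.
Proof.
by case: k => [//|k] [df _] x; exact: differentiable_continuous.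
Qed.

Lemma Ck_weaken V W k (f : V -> W) : Ck k.+1 f -> Ck k f.
Proof.
elim: k f => [f /Ck_continuous //|k IH f [df Df]].
by split=> // v; exact/IH/Df.
Qed.

Lemma Ck_cst V W k (w : W) : Ck k (cst w : V -> W).
Proof.
elim: k w => [w x|k IH w /=]; first exact: cvg_cst.
split=> [x|v]; first exact: differentiable_cst.
rewrite [X in Ck k X](_ : _ = cst 0) //.
by apply/funext => x; exact: derive_cst.
Qed.

Lemma CkD V W k (f g : V -> W) : Ck k f -> Ck k g -> Ck k (f \+ g).
Proof.
elim: k f g => [f g fc gc x|k IH f g [df Df] [dg Dg]] /=.
  by apply: continuousD; [exact: fc|exact: gc].
split=> [x|v]; first exact: differentiableD.
rewrite [X in Ck k X](_ : _ = (fun x => 'D_v f x) \+ (fun x => 'D_v g x)).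
  by apply: IH; [exact: Df|exact: Dg].
by apply/funext => x; rewrite deriveD//; exact: diff_derivable.
Qed.

Lemma CkM V k (f g : V -> R) : Ck k f -> Ck k g -> Ck k (f \* g).
Proof.
elim: k f g => [f g fc gc x|k IH f g cf cg].
  by apply: continuousM; [exact: fc|exact: gc].
have [df Df] := cf; have [dg Dg] := cg.
split=> [x|v]; first exact: differentiableM.
rewrite [X in Ck k X](_ : _ =
    (f \* (fun x => 'D_v g x)) \+ (g \* (fun x => 'D_v f x))).
  by apply: CkD; apply: IH; do ?[exact: Ck_weaken|exact: Df|exact: Dg].
by apply/funext => x; rewrite deriveM//; exact: diff_derivable.
Qed.

Lemma Ck_sum V W k n (f : 'I_n -> V -> W) :
  (forall i, Ck k (f i)) -> Ck k (fun x => \sum_i f i x).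
Proof.
move=> cf; rewrite [X in Ck k X](_ : _ = \big[(fun f g => f \+ g)/cst 0]_i f i).
  by apply: big_ind => //; [exact: Ck_cst|exact: CkD].
by apply/funext => x; apply: (big_ind2 (fun a (b : V -> W) => a = b x)) => //=
  a b c d -> ->.
Qed.

(** * Maps into row vectors: coordinates and the chain rule *)

Lemma differentiable_coord_comp V n (f : V -> 'rV[R]_n) i x :
  differentiable f x -> differentiable (fun x => f x 0 i) x.
Proof.
move=> df; apply: (@differentiable_comp _ _ _ _ f (fun M => M 0 i)) => //.
exact: differentiable_coord.
Qed.

Lemma derive_coord V n (f : V -> 'rV[R]_n) i x v :
  differentiable f x -> 'D_v f x 0 i = 'D_v (fun x => f x 0 i) x.
Proof. by move=> df; rewrite derive_mx ?mxE//; exact: diff_derivable. Qed.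

Lemma row_functionE V n (f : V -> 'rV[R]_n) :
  f = fun x => \sum_j f x 0 j *: delta_mx 0 j.
Proof. by apply/funext => x; exact: row_sum_delta. Qed.

Lemma differentiable_row V n (f : V -> 'rV[R]_n) x :
  (forall i, differentiable (fun x => f x 0 i) x) -> differentiable f x.
Proof.
move=> df; rewrite (row_functionE f).
rewrite [X in differentiable X _](_ : _ =
    \sum_j (fun x => f x 0 j *: delta_mx 0 j)).
  by apply: differentiable_sum => j; exact: differentiableZl.
by apply/funext => y; rewrite fct_sumE.
Qed.

(** Reduces C^k regularity to scalar functions, for which products are available. The induction
    works because directional derivatives commute with taking coordinates. *)
Lemma Ck_rowP V n k (f : V -> 'rV[R]_n) :
  Ck k f <-> forall i, Ck k (fun x => f x 0 i).
Proof.
elim: k f => [f|k IH f]; split.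
- move=> cf i x; apply: (@continuous_comp _ _ _ f (fun M => M 0 i)).
    exact: cf.
  by apply: coord_continuous.
- move=> cf; rewrite (row_functionE f).
  apply: (@Ck_sum V _ 0 n (fun j x => f x 0 j *: delta_mx 0 j)) => j x /=.
  apply: cvgZr_tmp; exact: cf.
- move=> [df Df] i; split=> [x|v]; first exact: differentiable_coord_comp.
  rewrite [X in Ck k X](_ : _ = fun x => 'D_v f x 0 i).
    by have /IH := Df v.
  by apply/funext => x; rewrite derive_coord.
- move=> cf; have df x : differentiable f x.
    by apply: differentiable_row => i; case: (cf i).
  split=> // v; apply/IH => i.
  rewrite [X in Ck k X](_ : _ = 'D_v (fun x => f x 0 i)); last first.
    by apply/funext => x; rewrite derive_coord.
  by have [_] := cf i; apply.
Qed.

Lemma derive_comp V n (W : normedModType R) (f : V -> 'rV[R]_n)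
    (g : 'rV[R]_n -> W) x v :
  differentiable f x -> differentiable g (f x) ->
  'D_v (g \o f) x = 'D_('D_v f x) g (f x).
Proof.
move=> df dg; have dgf : differentiable (g \o f) x.
  exact: differentiable_comp.
by rewrite (deriveE v dgf) (deriveE _ dg) (deriveE v df) diff_comp.
Qed.

(** In the chain rule [g] is differentiated along ['D_v f x], which varies with [x], whereas [Ck]
    only speaks of fixed directions. Expanding this vector in the standard basis leaves fixed
    directions with scalar coefficients. *)
Lemma derive_comp_row V n (f : V -> 'rV[R]_n) (g : 'rV[R]_n -> R) x v :
  differentiable f x -> differentiable g (f x) ->
  'D_v (g \o f) x =
  \sum_i 'D_v (fun x => f x 0 i) x * 'D_(delta_mx 0 i) g (f x).
Proof.
move=> df dg; rewrite derive_comp// deriveE// [X in 'd _ _ X]row_sum_delta.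
rewrite linear_sum; apply: eq_bigr => i _.
by rewrite linearZ/= derive_coord// (deriveE _ dg).
Qed.

Lemma Ck_comp_row V n k (f : V -> 'rV[R]_n) (g : 'rV[R]_n -> R) :
  Ck k f -> Ck k g -> Ck k (g \o f).
Proof.
elim: k f g => [f g cf cg x|k IH f g cf cg].
  by apply: continuous_comp; [exact: cf|exact: cg].
have [df Df] := cf; have [dg Dg] := cg.
split=> [x|v]; first exact: differentiable_comp.
rewrite [X in Ck k X](_ : _ = fun x => \sum_i
  ((fun x => 'D_v (fun x => f x 0 i) x) \*
   ((fun y => 'D_(delta_mx 0 i) g y) \o f)) x).
  apply: Ck_sum => i; apply: CkM.
    by have [_] := (Ck_rowP k.+1 f).1 cf i; apply.
  by apply: IH; [exact: Ck_weaken|exact: Dg].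
by apply/funext => x; rewrite derive_comp_row.
Qed.

Lemma smooth_comp V m n (f : V -> 'rV[R]_m) (g : 'rV[R]_m -> 'rV[R]_n) :
  smooth f -> smooth g -> smooth (g \o f).
Proof.
move=> sf sg k; apply/Ck_rowP => i.
have /Ck_rowP/(_ i) := sg k; exact: Ck_comp_row.
Qed.

Lemma smooth_differentiable V W (f : V -> W) x : smooth f -> differentiable f x.
Proof. by move=> /(_ 1%N)[]. Qed.

Lemma smooth_continuous V W (f : V -> W) : smooth f -> continuous f.
Proof. by move=> /(_ 0%N). Qed.

Lemma smooth_rowP V n (f : V -> 'rV[R]_n) :
  smooth f <-> forall i, smooth (fun x => f x 0 i).
Proof.
split=> sf; first by move=> i k; exact: (Ck_rowP k f).1.
by move=> k; apply/Ck_rowP => i; exact: sf.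
Qed.

Lemma smooth_cst V W (w : W) : smooth (cst w : V -> W).
Proof. by move=> k; exact: Ck_cst. Qed.

Lemma smoothD V W (f g : V -> W) : smooth f -> smooth g -> smooth (f \+ g).
Proof. by move=> sf sg k; exact: CkD. Qed.

Lemma smoothM V (f g : V -> R) : smooth f -> smooth g -> smooth (f \* g).
Proof. by move=> sf sg k; exact: CkM. Qed.

Lemma smooth_id V : smooth (@id V).
Proof.
case=> [|k]; first by move=> x; exact: id.
split=> [x|v]; first by [].
rewrite [X in Ck k X](_ : _ = cst v); first exact: Ck_cst.
by apply/funext => x; exact: derive_id.
Qed.

Lemma smooth_coord n (i : 'I_n) : smooth (fun p : 'rV[R]_n => p 0 i).
Proof. exact: (smooth_rowP (@id 'rV[R]_n)).1 (@smooth_id _) i. Qed.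

End Ck_theory.

(** * Symplectic diffeomorphisms and Lagrangians *)

Section diffeomorphisms.
Variable R : realType.

Definition diffeo n (F G : 'rV[R]_n -> 'rV[R]_n) : Prop :=
  [/\ smooth F, smooth G, cancel F G & cancel G F].

Lemma diffeo_sym n (F G : 'rV[R]_n -> 'rV[R]_n) : diffeo F G -> diffeo G F.
Proof. by case. Qed.

Lemma diffeo_comp n (F1 G1 F2 G2 : 'rV[R]_n -> 'rV[R]_n) :
  diffeo F1 G1 -> diffeo F2 G2 -> diffeo (F1 \o F2) (G2 \o G1).
Proof.
move=> [sF1 sG1 FK1 GK1] [sF2 sG2 FK2 GK2].
by split; [exact: smooth_comp|exact: smooth_comp|exact: can_comp..].
Qed.

Lemma diffeo_diffK n (F G : 'rV[R]_n -> 'rV[R]_n) p v :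
  diffeo F G -> 'd G (F p) ('d F p v) = v.
Proof.
move=> [sF sG FK _].
have dF : differentiable F p by exact: smooth_differentiable.
have dG : differentiable G (F p) by exact: smooth_differentiable.
have GF : G \o F = id by apply/funext => x /=; rewrite FK.
rewrite -[LHS]/(('d G (F p) \o 'd F p) v) -(diff_comp dF dG) GF.
by rewrite diff_val.
Qed.

Lemma diffeo_diffVK n (F G : 'rV[R]_n -> 'rV[R]_n) p v :
  diffeo F G -> 'd F p ('d G (F p) v) = v.
Proof.
move=> FG; have [_ _ FK _] := FG.
by have := diffeo_diffK (F p) v (diffeo_sym FG); rewrite FK.
Qed.

Lemma tangent_image n (F G : 'rV[R]_n -> 'rV[R]_n) (A : set 'rV[R]_n) p v :
  diffeo F G -> tangent A p v -> tangent (F @` A) (F p) ('d F p v).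
Proof.
move=> [sF sG FK GK] [c [sc <- cA <-]]; exists (F \o c); split=> //.
- exact: smooth_comp.
- by near=> t; exists (c t) => //; near: t.
- rewrite !derive1E derive_comp; try exact: smooth_differentiable.
  by rewrite deriveE//; exact: smooth_differentiable.
Unshelve. all: by end_near. Qed.

Lemma transverse_image n (F G : 'rV[R]_n -> 'rV[R]_n) (A B : set 'rV[R]_n) :
  diffeo F G -> transverse A B -> transverse (F @` A) (F @` B).
Proof.
move=> FG tAB _ [p Ap <-] [q Bq qp] v.
have [_ _ FK _] := FG; have {qp}? := can_inj FK qp; subst q.
(* The vector is pulled back by the differential of [G], split at [p], and both parts are pushed
   forward again. *)
have [u [w [tu tw vuw]]] := tAB p Ap Bq ('d G (F p) v).
exists ('d F p u), ('d F p w); split;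
  [exact: tangent_image FG tu|exact: tangent_image FG tw|].
by rewrite -linearD -vuw (diffeo_diffVK _ _ FG).
Qed.

Lemma smooth_embedding_comp m n (f : 'rV[R]_m -> 'rV[R]_n)
    (F G : 'rV[R]_n -> 'rV[R]_n) :
  diffeo F G -> smooth_embedding f -> smooth_embedding (F \o f).
Proof.
move=> FG [sf inj_f inj_df open_f]; have [sF sG FK GK] := FG.
split; [exact: smooth_comp|exact: inj_comp (can_inj FK) inj_f| |].
- move=> u; rewrite diff_comp; try exact: smooth_differentiable.
  apply: inj_comp (inj_df u); apply: (@can_inj _ _ _ ('d G (F (f u)))) => v.
  exact: diffeo_diffK.
(* The preimage of [Q] under [G] is the image of [Q] under [F], and it is open by continuity of
   [G]. *)
- move=> U /open_f[Q oQ fU]; exists (G @^-1` Q).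
    by apply: open_comp => // x _; exact: smooth_continuous.
  rewrite -(image_comp f F U) fU; apply/seteqP; split.
    move=> _ [x [Qx [y _ yx]] <-]; split; first by rewrite /= FK.
    by exists y; rewrite //= yx.
  move=> x [Qx [y _ yx]]; exists (f y) => //; split; last by exists y.
  by move: Qx; rewrite -yx /= FK.
Qed.

Definition symplectic (F : 'rV[R]_4 -> 'rV[R]_4) : Prop :=
  forall p v w, omega ('d F p v) ('d F p w) = omega v w.

Lemma symplectic_comp (F G : 'rV[R]_4 -> 'rV[R]_4) :
  smooth F -> smooth G -> symplectic F -> symplectic G -> symplectic (F \o G).
Proof.
move=> sF sG wF wG p v w; rewrite diff_comp; try exact: smooth_differentiable.
by rewrite /= wF wG.
Qed.

(** [F] is asked to be the identity only at points of [L] outside a compact set: the maps used below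
    may move points of R^4 arbitrarily far from the origin. *)
Lemma flat_planar_lagrangian_image (F G : 'rV[R]_4 -> 'rV[R]_4)
    (L : set 'rV[R]_4) :
  diffeo F G -> symplectic F ->
  (exists2 K, compact K & forall p, L p -> ~ K p -> F p = p) ->
  flat_planar_lagrangian L -> flat_planar_lagrangian (F @` L).
Proof.
move=> FG wF [K2 cK2 FK2] [[f ef fL] wL [K1 cK1 LK1]].
have [sF sG FK GK] := FG.
have GFL : G @` (F @` L) = L.
  by rewrite image_comp (_ : G \o F = id) ?image_id//; apply/funext => x /=.
split.
- exists (F \o f); first exact: smooth_embedding_comp FG ef.
  by rewrite -fL image_comp.
- move=> _ v w [p Lp <-] tv tw.
  (* Tangent vectors of the image are carried back by [G] to [L], where [omega] vanishes on them;
     [F] preserves [omega]. *)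
  have := tangent_image (diffeo_sym FG) tv.
  have := tangent_image (diffeo_sym FG) tw.
  rewrite GFL FK => tw' tv'; rewrite -(wL _ _ _ Lp tv' tw').
  rewrite -(wF p ('d G (F p) v)); apply/esym.
  exact: congr2 (diffeo_diffVK p v FG) (diffeo_diffVK p w FG).
- have LE p : ~ K1 p -> (L p <-> L0 p).
    move=> nK; have /seteqP[LL0 L0L] := LK1.
    by split=> [Lp|Lp]; [have [] := LL0 p|have [] := L0L p].
  (* Outside [K1] and [K2], [L] agrees with [L0] and is fixed by [F]. The image under [F] is added
     so that a point outside the whole set comes from a point outside [K1] and [K2]. *)
  exists (K1 `|` K2 `|` F @` (K1 `|` K2)).
    apply: compactU; first exact: compactU.
    apply: continuous_compact; last exact: compactU.
    by apply: continuous_subspaceT; exact: smooth_continuous.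
  apply/seteqP; split=> [_ [[q Lq <-] nK]|p [L0p nK]].
    have nKq : ~ (K1 `|` K2) q by move=> Kq; apply: nK; right; exists q.
    split=> //; rewrite FK2//; last by move=> Kq; apply: nKq; right.
    by apply/LE => // Kq; apply: nKq; left.
  have nK1 : ~ K1 p by move=> Kp; apply: nK; left; left.
  have nK2 : ~ K2 p by move=> Kp; apply: nK; left; right.
  by split=> //; exists p; [exact/LE|apply: FK2 => //; exact/LE].
Qed.

End diffeomorphisms.

(** * The shear and the lift of a plane map *)

Section shifted_lift.
Variable R : realType.
Implicit Types (p v w : 'rV[R]_4) (phi : 'rV[R]_2 -> 'rV[R]_2).

Definition row4 (a b c d : R) : 'rV[R]_4 := \row_j [:: a; b; c; d]`_j.

Definition plane p : 'rV[R]_2 := \row_j [:: x1 p; y1 p]`_j.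

Lemma x1_row4 a b c d : x1 (row4 a b c d) = a. Proof. by rewrite /x1 mxE. Qed.
Lemma x2_row4 a b c d : x2 (row4 a b c d) = b. Proof. by rewrite /x2 mxE. Qed.
Lemma y1_row4 a b c d : y1 (row4 a b c d) = c. Proof. by rewrite /y1 mxE. Qed.
Lemma y2_row4 a b c d : y2 (row4 a b c d) = d. Proof. by rewrite /y2 mxE. Qed.
Definition row4E := (x1_row4, x2_row4, y1_row4, y2_row4).

Lemma row4_eta p : row4 (x1 p) (x2 p) (y1 p) (y2 p) = p.
Proof.
apply/rowP; case; case=> [|[|[|[|//]]]] h; rewrite mxE /=;
  by congr (p 0 _); apply: val_inj.
Qed.

Lemma plane_eta (z : 'rV[R]_2) : \row_j [:: z 0 0; z 0 1]`_j = z.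
Proof.
apply/rowP; case; case=> [|[|//]] h; rewrite mxE /=;
  by congr (z 0 _); apply: val_inj.
Qed.

Lemma smooth_row4 (f0 f1 f2 f3 : 'rV[R]_4 -> R) :
  smooth f0 -> smooth f1 -> smooth f2 -> smooth f3 ->
  smooth (fun p => row4 (f0 p) (f1 p) (f2 p) (f3 p)).
Proof.
move=> s0 s1 s2 s3; apply/smooth_rowP; case; case=> [|[|[|[|//]]]] h;
  by under eq_fun do rewrite mxE /=.
Qed.

Lemma smooth_plane : smooth plane.
Proof.
apply/smooth_rowP; case; case=> [|[|//]] h;
  under eq_fun do rewrite mxE /=; exact: smooth_coord.
Qed.

Lemma is_derive_coord n (i : 'I_n) (p v : 'rV[R]_n) :
  is_derive p v (fun q => q 0 i) (v 0 i).
Proof.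
split; first by apply: diff_derivable; exact: differentiable_coord.
by rewrite -(@derive_coord R _ _ id)// derive_id.
Qed.

(** These instances let [derive_val] compute derivatives of expressions in the coordinates. *)
Instance is_derive_x1 p v : is_derive p v (@x1 R) (x1 v).
Proof. exact: is_derive_coord. Qed.
Instance is_derive_x2 p v : is_derive p v (@x2 R) (x2 v).
Proof. exact: is_derive_coord. Qed.
Instance is_derive_y1 p v : is_derive p v (@y1 R) (y1 v).
Proof. exact: is_derive_coord. Qed.
Instance is_derive_y2 p v : is_derive p v (@y2 R) (y2 v).
Proof. exact: is_derive_coord. Qed.

Lemma diff_row4 (f0 f1 f2 f3 : 'rV[R]_4 -> R) p v :
  smooth f0 -> smooth f1 -> smooth f2 -> smooth f3 ->
  'd (fun p => row4 (f0 p) (f1 p) (f2 p) (f3 p)) p v =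
  row4 ('D_v f0 p) ('D_v f1 p) ('D_v f2 p) ('D_v f3 p).
Proof.
move=> s0 s1 s2 s3; have sf := smooth_row4 s0 s1 s2 s3.
have df := smooth_differentiable p sf.
rewrite -deriveE//; apply/rowP; case; case=> [|[|[|[|//]]]] h;
  by rewrite derive_coord// mxE; under eq_fun do rewrite mxE /=.
Qed.

Lemma diff_plane p v : 'd plane p v = plane v.
Proof.
have dp := smooth_differentiable p smooth_plane.
rewrite -deriveE//; apply/rowP; case; case=> [|[|//]] h;
  rewrite derive_coord// mxE; under eq_fun do rewrite mxE /=; exact: derive_val.
Qed.

(* The time-one map of the Hamiltonian [c * (y2 - a) ^ 2 * x1], up to sign. *)
Definition shear (a c : R) p : 'rV[R]_4 :=
  row4 (x1 p) (x2 p - (c *+ 2) * ((y2 p - a) * x1 p))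
    (y1 p + c * ((y2 p - a) * (y2 p - a))) (y2 p).

(** The two nontrivial coordinates of the shear, written with pointwise operations on functions so
    that [smoothD] and [smoothM] apply. *)
Let shear_x2 a c : 'rV[R]_4 -> R :=
  @x2 R \+ (cst (- (c *+ 2)) \* ((@y2 R \+ cst (- a)) \* @x1 R)).
Let shear_y1 a c : 'rV[R]_4 -> R :=
  @y1 R \+ (cst c \* ((@y2 R \+ cst (- a)) \* (@y2 R \+ cst (- a)))).

Let shearE a c : shear a c =
  fun p => row4 (x1 p) (shear_x2 a c p) (shear_y1 a c p) (y2 p).
Proof. by apply/funext => p; rewrite /shear /shear_x2 /= mulNr. Qed.

Let smooth_shear_x2 a c : smooth (shear_x2 a c).
Proof.
apply: smoothD; first exact: smooth_coord.
apply: smoothM; first exact: smooth_cst.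
apply: smoothM; last exact: smooth_coord.
by apply: smoothD; [exact: smooth_coord|exact: smooth_cst].
Qed.

Let smooth_shear_y1 a c : smooth (shear_y1 a c).
Proof.
have sy : smooth (@y2 R \+ cst (- a)).
  by apply: smoothD; [exact: smooth_coord|exact: smooth_cst].
apply: smoothD; first exact: smooth_coord.
by apply: smoothM; [exact: smooth_cst|exact: smoothM].
Qed.

Lemma smooth_shear a c : smooth (shear a c).
Proof. by rewrite shearE; apply: smooth_row4 => //; exact: smooth_coord. Qed.

(** The increments of x2 and y1 depend only on x1 and y2, which the shear leaves unchanged; hence
    opposite values of [c] cancel. *)
Lemma shearK a c : cancel (shear a c) (shear a (- c)).
Proof.
move=> p; rewrite -[RHS]row4_eta /shear !row4E.
by congr (row4 _ _ _ _); ring.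
Qed.

Lemma diffeo_shear a c : diffeo (shear a c) (shear a (- c)).
Proof.
split; [exact: smooth_shear..|exact: shearK|].
by move=> p; rewrite -{1}[c]opprK shearK.
Qed.

(** The cross terms in x1 and y2 coming from the two symplectic pairs are opposite, and the
    remaining term is symmetric in [v] and [w], so it drops out. *)
Lemma symplectic_shear a c : symplectic (shear a c).
Proof.
move=> p v w; have dE u : 'd (shear a c) p u = row4 (x1 u)
    (x2 u - (c *+ 2) * ((y2 p - a) * x1 u + x1 p * y2 u))
    (y1 u + c * ((y2 p - a) * y2 u *+ 2)) (y2 u).
  rewrite shearE diff_row4//; try exact: smooth_coord.
  congr row4; try exact: derive_val.
  - rewrite (_ : shear_x2 a c =
      @x2 R - (c *+ 2) *: ((@y2 R - cst a) * @x1 R)); last first.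
      by apply/funext => q; rewrite /shear_x2 /= mulNr.
    by rewrite derive_val !fctE; rewrite subr0.
  - rewrite (_ : shear_y1 a c =
      @y1 R + c *: ((@y2 R - cst a) * (@y2 R - cst a))); last first.
      by apply/funext => q.
    have dy := is_deriveB (is_derive_y2 p u) (is_derive_cst a p u).
    have := is_deriveD (is_derive_y1 p u) (is_deriveZ c (is_deriveM dy dy)).
    by case=> _ ->; rewrite !fctE subr0.
rewrite !dE /omega !row4E; ring.
Qed.

(** * The lift of a plane map to R^4 *)

Definition plane_lift phi p : 'rV[R]_4 :=
  row4 (phi (plane p) 0 0) (x2 p) (phi (plane p) 0 1) (y2 p).

Lemma plane_row4 a b c d : plane (row4 a b c d) = \row_j [:: a; c]`_j.
Proof. by rewrite /plane !row4E. Qed.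

Lemma smooth_plane_comp phi i :
  smooth phi -> smooth (fun p => phi (plane p) 0 i).
Proof.
move=> sphi; apply: (smooth_rowP (phi \o plane)).1.
exact: smooth_comp smooth_plane sphi.
Qed.

Lemma smooth_plane_lift phi : smooth phi -> smooth (plane_lift phi).
Proof.
move=> sphi; apply: smooth_row4; do ?[exact: smooth_plane_comp];
  exact: smooth_coord.
Qed.

Lemma plane_liftK phi psi :
  cancel phi psi -> cancel (plane_lift phi) (plane_lift psi).
Proof.
move=> phiK p; rewrite {1}/plane_lift plane_row4 plane_eta phiK !row4E.
by rewrite /plane !mxE /= row4_eta.
Qed.

Lemma diff_plane_lift phi p v : smooth phi ->
  'd (plane_lift phi) p v =
  row4 ('d phi (plane p) (plane v) 0 0) (x2 v)
       ('d phi (plane p) (plane v) 0 1) (y2 v).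
Proof.
move=> sphi; rewrite diff_row4; do ?[exact: smooth_plane_comp];
  do ?[exact: smooth_coord].
have dphi := smooth_differentiable (plane p) sphi.
have dpl := smooth_differentiable p smooth_plane.
have E i : 'D_v (fun p => phi (plane p) 0 i) p = 'd phi (plane p) (plane v) 0 i.
  rewrite -(derive_coord (f := phi \o plane)); last exact: differentiable_comp.
  by rewrite derive_comp// (deriveE _ dpl) diff_plane deriveE.
by rewrite !E !derive_val.
Qed.

(** [omega] is the sum of [area] in the x1 y1-plane, which [phi] preserves, and of the area form of
    the x2 y2-plane, where the lift is the identity. *)
Lemma symplectic_plane_lift phi : smooth phi ->
  (forall z v w : 'rV[R]_2, area ('d phi z v) ('d phi z w) = area v w) ->
  symplectic (plane_lift phi).
Proof.
move=> sphi aphi p v w; rewrite /omega !diff_plane_lift// !row4E.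
congr (_ + _); have := aphi (plane p) (plane v) (plane w).
by rewrite /area !mxE /=.
Qed.

End shifted_lift.

(** * Changing one slice *)

Section slices.
Variable R : realType.
Implicit Types (phi psi : 'rV[R]_2 -> 'rV[R]_2).

Lemma compact_coord_bounded n (i : 'I_n) (K : set 'rV[R]_n) :
  compact K -> exists M : R, 0 <= M /\ forall p, K p -> `|p 0 i| <= M.
Proof.
move=> cK.
have /compact_bounded[N [_ HN]] : compact ((fun p : 'rV[R]_n => p 0 i) @` K).
  apply: continuous_compact => //; apply: continuous_subspaceT.
  exact/smooth_continuous/smooth_coord.
(* Boundedness provides a bound for every number strictly above [N]; this choice is also
   nonnegative. *)
exists (`|N| + 1); split=> [|p Kp]; first by rewrite addr_ge0.
apply: (HN (`|N| + 1)); last by exists p.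
by rewrite (le_lt_trans (ler_norm N)) ?ltrDl.
Qed.

(** * Area-preserving diffeomorphisms and the equivalence of slices *)

Lemma compact_area_diffeo_inv phi : compact_area_diffeo phi ->
  exists psi, [/\ compact_area_diffeo psi, cancel phi psi & cancel psi phi].
Proof.
move=> [sphi [psi [spsi phiK psiK]] aphi [K cK Kphi]].
have psiphi : diffeo psi phi by split.
exists psi; split; [split|exact: phiK|exact: psiK].
- exact: spsi.
- by exists phi; split.
(* [phi] preserves area at [psi p], and its differential there undoes that of [psi] at [p]. *)
- move=> p v w; rewrite -(aphi (psi p) ('d psi p v)).
  exact: congr2 (diffeo_diffK p v psiphi) (diffeo_diffK p w psiphi).
- by exists K => // p nKp; rewrite -{1}(Kphi p nKp) phiK.
Qed.

Lemma compact_area_diffeo_comp phi psi :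
  compact_area_diffeo phi -> compact_area_diffeo psi ->
  compact_area_diffeo (psi \o phi).
Proof.
move=> [sphi [phi' [sphi' phiK phi'K]] aphi [K cK Kphi]].
move=> [spsi [psi' [spsi' psiK psi'K]] apsi [K' cK' Kpsi]].
split; first exact: smooth_comp.
- exists (phi' \o psi'); split; [exact: smooth_comp|exact: can_comp..].
- by move=> p v w; rewrite diff_comp; [rewrite /= apsi aphi
    |exact: smooth_differentiable..].
- exists (K `|` K'); first exact: compactU.
  move=> p nK /=; rewrite Kphi ?Kpsi// => Kp; apply: nK; by [left|right].
Qed.

Lemma prod_id_comp phi psi q :
  prod_id (psi \o phi) q = prod_id psi (prod_id phi q).
Proof.
by rewrite {2}/prod_id /prod_id !mxE /= plane_eta.
Qed.

Lemma prod_idK phi psi : cancel phi psi -> cancel (prod_id phi) (prod_id psi).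
Proof.
move=> phiK q; rewrite -prod_id_comp /prod_id /= phiK.
apply/rowP; case; case=> [|[|[|//]]] h; rewrite !mxE /=;
  by congr (q 0 _); apply: val_inj.
Qed.

Lemma slice_equiv_sym (S T : set 'rV[R]_3) :
  slice_equiv S T -> slice_equiv T S.
Proof.
move=> [phi /compact_area_diffeo_inv[psi [apsi phiK _]] <-]; exists psi => //.
rewrite image_comp (_ : _ \o _ = id) ?image_id//.
by apply/funext => q /=; rewrite prod_idK.
Qed.

Lemma slice_equiv_trans (S T U : set 'rV[R]_3) :
  slice_equiv S T -> slice_equiv T U -> slice_equiv S U.
Proof.
move=> [phi aphi <-] [psi apsi <-].
exists (psi \o phi); first exact: compact_area_diffeo_comp.
rewrite image_comp; congr image; apply/funext => q; exact: prod_id_comp.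
Qed.

(** * Moving a slice inside its level *)

Lemma i_levelE a (q : 'rV[R]_3) :
  i_level a q = row4 (q 0 0) (q 0 2%:R) (q 0 1) a.
Proof. by []. Qed.

Lemma y2_i_level a (q : 'rV[R]_3) : y2 (i_level a q) = a.
Proof. by rewrite i_levelE row4E. Qed.

Lemma plane_lift_i_level phi a q :
  plane_lift phi (i_level a q) = i_level a (prod_id phi q).
Proof.
by rewrite !i_levelE /plane_lift plane_row4 !row4E /prod_id !mxE.
Qed.

Lemma shear_level a c (p : 'rV[R]_4) : y2 p = a -> shear a c p = p.
Proof.
by move=> pa; rewrite /shear pa subrr !mul0r !mulr0 subr0 addr0 -pa row4_eta.
Qed.

(** [e] is the half-width of the band around the level [a] in which points of [L] may move. The
    bound [e <= - a] keeps y2 = 0, and with it the flat end of [L], out of the open band. *)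
Lemma change_slice (L : set 'rV[R]_4) (a e : R) phi :
  flat_planar_lagrangian L -> 0 < e -> e <= - a -> compact_area_diffeo phi ->
  exists L' : set 'rV[R]_4,
    [/\ flat_planar_lagrangian L',
        forall t, transverse L (y2_level t) -> transverse L' (y2_level t),
        forall t, e <= `|t - a| -> slice L' t = slice L t &
        forall S, i_level a @` S = slice L a ->
          i_level a @` (prod_id phi @` S) = slice L' a].
Proof.
move=> fL e0 ea aphi.
have [_ _ [K cK LK]] := fL.
have [sphi [psi [spsi phiK psiK]] phia [K' cK' phiK']] := aphi.
(* Both bounds concern y1, which has index 2 in R^4 and index 1 in the plane: [M] bounds it on [K],
   hence from above on all of [L], and [M'] on a compact set outside which [phi] is the identity. *)
have [M [M0 HM]] := @compact_coord_bounded 4 2%:R K cK.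
have [M' [M'0 HM']] := @compact_coord_bounded 2 1 K' cK'.
(* With this [c], at distance at least [e] from the level [a], the inverse shear lowers y1 by at
   least [M + M' + 1]. Points of [L] thus land where y1 is below [- M'], outside [K']. *)
pose c := (M + M' + 1) / (e * e).
pose F := shear a c \o plane_lift phi \o shear a (- c).
pose G := shear a c \o plane_lift psi \o shear a (- c).
have FG : diffeo F G.
  have dl : diffeo (plane_lift phi) (plane_lift psi).
    by split; do ?exact: smooth_plane_lift; exact: plane_liftK.
  apply: (diffeo_comp (diffeo_comp (diffeo_shear a c) dl)).
  exact/diffeo_sym/diffeo_shear.
have [sF sG FK GK] := FG.
have wF : symplectic F.
  apply: symplectic_comp; [|exact: smooth_shear| |exact: symplectic_shear].
    by apply: smooth_comp; [exact: smooth_plane_lift|exact: smooth_shear].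
  apply: symplectic_comp; [exact: smooth_shear|exact: smooth_plane_lift|
    exact: symplectic_shear|exact: symplectic_plane_lift].
have y2F p : y2 (F p) = y2 p by rewrite /F /= /shear !row4E.
have y2G p : y2 (G p) = y2 p by rewrite /G /= /shear !row4E.
have L0E p : L p -> ~ K p -> y1 p = 0 /\ y2 p = 0.
  by move=> Lp nKp; have /seteqP[/(_ p) LL0 _] := LK; case: LL0.
have y1L p : L p -> y1 p <= M.
  move=> Lp; have [Kp|nKp] := pselect (K p).
    by rewrite (le_trans (ler_norm _))// HM.
  by have [-> _] := L0E p Lp nKp.
have Ffix p : L p -> e <= `|y2 p - a| -> F p = p.
  move=> Lp ep.
  (* If the lift fixes the sheared point, the two opposite shears in [F] cancel. *)
  suff E : plane_lift phi (shear a (- c) p) = shear a (- c) p.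
    by rewrite /F /= E -{1}[c]opprK shearK.
  rewrite -[RHS]row4_eta /plane_lift phiK'.
    by rewrite /plane !mxE.
  move=> /HM'; rewrite mxE /= /shear row4E mulNr.
  have : M + M' + 1 <= c * ((y2 p - a) * (y2 p - a)).
    rewrite /c mulrAC ler_pdivlMr ?mulr_gt0// ler_wpM2l//.
      by rewrite !addr_ge0.
    rewrite -!expr2 -[leRHS]real_normK ?num_real//.
    by rewrite ler_pXn2r// nnegrE// ltW.
  have := y1L p Lp; rewrite ler_norml; lra.
(* Since [F] maps each level of y2 onto itself, transversality to a level passes to the image of
   [L]. *)
have LaF t : F @` y2_level t = y2_level t.
  apply/seteqP; split=> [_ [p <- <-]|p pt]; first by rewrite /y2_level /= y2F.
  by exists (G p); [rewrite /y2_level /= y2G|rewrite GK].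
exists (F @` L); split.
- apply: (flat_planar_lagrangian_image FG wF _ fL).
  (* Outside [K], points of [L] have y2 = 0, so their distance to the level [a] is [- a], at least
     [e]. *)
  exists K => // p Lp nKp; apply: Ffix => //.
  by have [_ ->] := L0E p Lp nKp; rewrite sub0r (le_trans ea)// ler_norm.
- by move=> t tL; rewrite -(LaF t); exact: transverse_image FG tL.
- move=> t et; apply/seteqP; split=> [_ [[p Lp <-]]|p [Lp pt]].
    rewrite /y2_level /= y2F => pt; rewrite Ffix ?pt//.
  by split=> //; exists p => //; apply: Ffix => //; rewrite pt.
- move=> S SL.
  (* Both shears fix the level [a] pointwise, so only the lift of [phi] acts there. *)
  have FS q : F (i_level a q) = i_level a (prod_id phi q).
    rewrite /F /= (shear_level (- c) (y2_i_level a q)) plane_lift_i_level.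
    exact: shear_level (y2_i_level _ _).
  rewrite image_comp (_ : _ \o _ = F \o i_level a); last first.
    by apply/funext => q /=; rewrite FS.
  rewrite -image_comp SL; apply/seteqP; split.
    move=> _ [p [Lp pa] <-]; split; first by exists p.
    by rewrite /y2_level /= y2F.
  move=> _ [[p Lp <-] pa]; exists p => //; split=> //.
  by move: pa; rewrite /y2_level /= y2F.
Qed.

Lemma slice_prec_equiv (S0 S1 T0 T1 : set 'rV[R]_3) :
  slice_equiv S0 S1 -> slice_equiv T0 T1 ->
  slice_prec S0 T0 -> slice_prec S1 T1.
Proof.
move=> [phi aphi <-] [psi apsi <-] [L [a [b [fL [ab b0] [tLa tLb] Sa Tb]]]].
have ba0 : 0 < b - a by rewrite subr_gt0.
(* The slice at [a] is changed first, with band half-width [b - a]: the level [b] is kept, and so is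
   y2 = 0 because [b] is negative. *)
have ea : b - a <= - a by rewrite gerDr ltW.
have [L1 [fL1 tL1 L1L L1S]] := change_slice fL ba0 ea aphi.
(* The change at [b] must spare both the level [a], already adjusted, and y2 = 0; hence the minimum
   of the two distances. *)
have e0 : 0 < Num.min (b - a) (- b) by rewrite lt_min ba0 oppr_gt0.
have eb : Num.min (b - a) (- b) <= - b by rewrite ge_min lexx orbT.
have [L2 [fL2 tL2 L2L L2S]] := change_slice fL1 e0 eb apsi.
exists L2, a, b; split=> //.
- by split; [apply/tL2/tL1|apply/tL2/tL1].
- rewrite L2L; first exact: L1S.
  by rewrite ge_min distrC ler_norm.
- by apply: L2S; rewrite L1L ?ler_norm.
Qed.

End slices.

Theorem proposition1p2 (R : realType) (S0 S1 T0 T1 : set 'rV[R]_3)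
    (hS0 : slices S0) (hS1 : slices S1) (hT0 : slices T0) (hT1 : slices T1)
    (hS : slice_equiv S0 S1) (hT : slice_equiv T0 T1) :
  (slice_prec S0 T0 <-> slice_prec S1 T1) /\
  (slice_preceq S0 T0 <-> slice_preceq S1 T1).
Proof.
(* The backward implications are the forward ones for the inverse equivalences. *)
have hS' := slice_equiv_sym hS; have hT' := slice_equiv_sym hT.
split; first by split; exact: slice_prec_equiv.
split=> -[] H; [left|right|left|right].
- exact: slice_prec_equiv H.
- exact: slice_equiv_trans (slice_equiv_trans hS' H) hT.
- exact: slice_prec_equiv H.
- exact: slice_equiv_trans (slice_equiv_trans hS H) hT'.
Qed.
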